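(* For every integer $n\ge 1$ there is a bijection from the set $\mathcal{R}_n$ of repetition sequences of length $n$ to the set of set partitions of $[n]=\{1,\dots,n\}$ that sends the number of repetitions of a sequence to the number of blocks minus one of the corresponding partition. In particular, $|\mathcal{R}_n|=B_n$, the $n$-th Bell number (the number of set partitions of $[n]$).
   Context: A repetition sequence of length $n$ is a sequence $a_1a_2\dots a_n$ of nonnegative integers with $a_1=0$ and, for each $i\ge 2$, $a_i\le 1+\#\{j\in[1,i-2]: a_j=a_{j+1}\}$. The number of repetitions of $a_1\dots a_n$ is $\#\{j\in[1,n-1]: a_j=a_{j+1}\}$. For example, $\mathcal{R}_3=\{000,001,002,010,011\}$. (In the paper, a partition is written with its blocks separated by dividers (slashes), so the number of dividers equals the number of blocks minus one.) *)

(* Defs.v *)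
From mathcomp Require Import all_boot.

Set Implicit Arguments.
Unset Strict Implicit.
Unset Printing Implicit Defensive.

(* The ground set {1, ..., n} is represented by 'I_n. Stated before importing
   classical_sets, which shadows finset's [partition] (nonempty, pairwise
   disjoint, covering blocks). *)
Definition set_partitions (n : nat) : {set {set {set 'I_n}}} :=
  [set P : {set {set 'I_n}} | partition P [set: 'I_n]].

Definition bell (n : nat) : nat := #|set_partitions n|.

(* Indices are 1-based: [term a i] is a_i, meaningful for 1 <= i <= size a. *)
Definition term (a : seq nat) (i : nat) : nat := nth 0 a i.-1.

(* #{ j in [1, m] : a_j = a_{j+1} } *)
Definition repetitions_upto (a : seq nat) (m : nat) : nat :=
  count (fun j => term a j == term a j.+1) (iota 1 m).

Definition repetitions (a : seq nat) : nat := repetitions_upto a (size a - 1).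

From mathcomp Require Import boolp classical_sets functions cardinality.
Local Open Scope classical_set_scope.

Definition repetition_sequences (n : nat) : set (n.-tuple nat) :=
  [set a : n.-tuple nat | term a 1 = 0 /\
    forall i, 2 <= i <= n -> term a i <= 1 + repetitions_upto a (i - 2)].

Arguments repetition_sequences n : clear implicits.

(* Main.v *)
(** If a_1 ... a_(i-1) has r repetitions, the admissible values of a_i are
    0, ..., r + 1, and a_(i-1) is one of them.  A word over {0, ..., r} with all
    r + 1 letters used is extended to a restricted growth word in just as many
    ways: by the new letter r + 1 or by one of the r + 1 old ones.  So send a
    repetition a_i = a_(i-1) to the new letter, and any other a_i to the old
    letter obtained by skipping the value a_(i-1).  Restricted growth words in
    turn correspond to set partitions through the kernels of the maps
    i |-> w_i, the distinct letters being the blocks. *)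

Require Import Defs.
From mathcomp Require Import all_boot finmap zify.
From mathcomp Require Import boolp classical_sets functions cardinality.

Set Implicit Arguments.
Unset Strict Implicit.
Unset Printing Implicit Defensive.

Local Open Scope classical_set_scope.
Local Open Scope card_scope.
Local Open Scope nat_scope.

(** * Repetition words and restricted growth words *)

(* Words are stored backwards, the last letter at the head, so that extending
   a word is [cons].  On a nonempty word [level] is the number of repetitions
   plus one: as [head x [::] = x], the first letter counts as a repetition. *)
Fixpoint level (l : seq nat) : nat :=
  if l is x :: l' then (x == head x l') + level l' else 0.

Fixpoint rep_list (l : seq nat) : bool :=
  if l is x :: l' then (x <= level l') && rep_list l' else true.

Fixpoint growth_list (v : seq nat) : bool :=
  if v is x :: v' then (x <= size (undup v')) && growth_list v' else true.

Fixpoint rep_to_growth (l : seq nat) : seq nat :=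
  if l is x :: l' then
    (if x == head x l' then level l' else unbump (head x l') x)
      :: rep_to_growth l'
  else [::].

Lemma size_rep_to_growth l : size (rep_to_growth l) = size l.
Proof. by elim: l => //= x l ->. Qed.

Lemma growth_list_mem v x :
  growth_list v -> (x \in v) = (x < size (undup v)).
Proof.
elim: v x => [|y v IHv] x //= /andP[le_y gv].
rewrite in_cons IHv //; case: ifP; rewrite IHv //= => ?; lia.
Qed.

Lemma head_le_level x l : rep_list l -> l != [::] -> head x l <= level l.
Proof. by case: l => //= y l /andP[le_y _] _; lia. Qed.

Lemma rep_to_growthP l :
  rep_list l ->
  growth_list (rep_to_growth l) /\ size (undup (rep_to_growth l)) = level l.
Proof.
elim: l => //= x l IHl /andP[le_x rl]; have [gl sl] := IHl rl.
rewrite gl sl andbT growth_list_mem // sl.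
have [xh|xh] := eqVneq; first by rewrite leqnn ltnn /= sl.
have ln0 : l != [::] by apply: contraNneq xh => ->.
have := head_le_level x rl ln0.
move=> le_h; have -> : unbump (head x l) x < level l by rewrite /unbump; lia.
by rewrite sl /unbump; split=> //; lia.
Qed.

(** Once the tails agree, the value [level] can only come from a repetition, and [unbump] is
    injective away from the skipped value. *)
Lemma rep_to_growth_inj l1 l2 :
  rep_list l1 -> rep_list l2 -> rep_to_growth l1 = rep_to_growth l2 -> l1 = l2.
Proof.
elim: l1 l2 => [|x1 l1 IHl] [|x2 l2] //= /andP[le1 r1] /andP[le2 r2] [ex el].
move: (IHl _ r1 r2 el) => el12; rewrite -{}el12 {IHl el r2 l2} in ex le2 *.
congr (_ :: _); case: l1 => [|y l] in r1 le1 le2 ex *; first by rewrite /= in le1 le2; lia.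
have := head_le_level 0 r1 isT.
move: ex le1 le2; rewrite [head _ _]/= [head x2 _]/= [head 0 _]/= /unbump.
by move: (level _) => m; do 2!case: eqP; lia.
Qed.

Lemma rep_to_growth_surj v :
  growth_list v -> exists2 l, rep_list l & rep_to_growth l = v.
Proof.
elim: v => [|w v IHv] /=; first by exists [::].
case/andP=> le_w /IHv[l rl defv]; have [_ sl] := rep_to_growthP rl.
rewrite -defv sl in le_w *.
have [l0|ln0] := eqVneq l [::].
  by exists [:: 0]; rewrite l0 // in le_w *; congr (_ :: _); move: le_w => /=; lia.
have le_h := head_le_level 0 rl ln0.
(* A new letter decodes to a repetition of the previous letter; for an old letter, [bump] undoes the
   skip. *)
exists ((if w == level l then head 0 l else bump (head 0 l) w) :: l).
  by rewrite /= rl andbT /bump; case: eqP; lia.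
have hE x : head x l = head 0 l by case: (l) ln0.
rewrite /= !hE /bump /unbump; congr (_ :: _); case: (w =P _) => ?; case: eqP; lia.
Qed.

(** * Restricted growth words and their kernels *)

Lemma growth_list_kernel_inj v1 v2 :
  growth_list v1 -> growth_list v2 -> size v1 = size v2 ->
  (forall i j, i < size v1 -> j < size v1 ->
     (nth 0 v1 i == nth 0 v1 j) = (nth 0 v2 i == nth 0 v2 j)) ->
  v1 = v2.
Proof.
elim: v1 v2 => [|x1 v1 IHv] [|x2 v2] //= /andP[le1 g1] /andP[le2 g2] [es] ker.
have ev : v1 = v2 by apply: IHv => // i j lti ltj; apply: (ker i.+1 j.+1).
rewrite -{}ev {IHv g2 es v2} in le2 ker *; congr (_ :: _).
have kerx i : i < size v1 -> (x1 == nth 0 v1 i) = (x2 == nth 0 v1 i).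
  by move=> lti; apply: (ker 0 i.+1).
have [/(nthP 0)[i lti xi]|x1v] := boolP (x1 \in v1).
  by move: (kerx i lti); rewrite xi eqxx => /esym/eqP->.
have [/(nthP 0)[i lti xi]|x2v] := boolP (x2 \in v1).
  by move: (kerx i lti); rewrite xi eqxx => /eqP.
move: x1v x2v; rewrite !growth_list_mem // -!leqNgt => ge1 ge2.
by apply: anti_leq; rewrite (leq_trans le1) ?(leq_trans le2).
Qed.

Lemma growth_list_kernel_surj (T : eqType) (x0 : T) (s : seq T) :
  exists v, [/\ growth_list v, size v = size s &
    forall i j, i < size s -> j < size s ->
      (nth 0 v i == nth 0 v j) = (nth x0 s i == nth x0 s j)].
Proof.
elim: s => [|x s [v [gv sv ker]]]; first by exists [::].
suff [w le_w kerw] : exists2 w, w <= size (undup v) &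
    forall i, i < size s -> (w == nth 0 v i) = (x == nth x0 s i).
  exists (w :: v); rewrite /= le_w gv sv; split=> // -[|i] [|j] lti ltj /=;
    rewrite ?eqxx ?kerw ?ker //.
  by rewrite eq_sym kerw // eq_sym.
have [xs|xs] := boolP (x \in s).
  have ltx : index x s < size s by rewrite index_mem.
  exists (nth 0 v (index x s)).
    by apply: ltnW; rewrite -growth_list_mem // mem_nth // sv.
  by move=> i lti; rewrite ker // nth_index.
exists (size (undup v)) => // i lti; apply/eqP/eqP => [wi|xi].
  have := mem_nth 0 (_ : i < size v); rewrite sv => /(_ lti).
  by rewrite -wi growth_list_mem // ltnn.
by rewrite xi mem_nth in xs.
Qed.

(** * Backward words and 1-based indices *)

Lemma repetitions_upto_rcons s x m :
  m < size s -> repetitions_upto (rcons s x) m = repetitions_upto s m.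
Proof.
move=> ltm; apply: eq_in_count => j; rewrite mem_iota => jm.
by rewrite /term !nth_rcons; do 2!case: ifP; lia.
Qed.

Lemma repetitions_uptoS s m :
  repetitions_upto s m.+1 =
  repetitions_upto s m + (term s m.+1 == term s m.+2).
Proof. by rewrite /repetitions_upto -[X in iota 1 X]addn1 iotaD count_cat /= addn0 add1n. Qed.

Lemma level_rev l : l != [::] -> level l = (repetitions (rev l)).+1.
Proof.
elim: l => [|x [|y l] IHl] // _; first by rewrite /= eqxx.
rewrite [level _]/= -/(level (y :: l)) IHl // addnS; congr _.+1.
rewrite /repetitions !size_rev /= !subn1 /= (rev_cons x) repetitions_uptoS.
rewrite repetitions_upto_rcons ?size_rev // addnC eq_sym; congr (_ + _).
rewrite /term /= !nth_rcons size_rev /= ltnSn ltnn eqxx.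
by rewrite rev_cons nth_rcons size_rev ltnn eqxx.
Qed.

Lemma rep_listP l :
  rep_list l <->
  term (rev l) 1 = 0 /\ forall i, 2 <= i <= size l ->
    term (rev l) i <= 1 + repetitions_upto (rev l) (i - 2).
Proof.
elim: l => [|x [|y l] IHl].
- by split=> // _; split=> // -[|[|i]].
- rewrite /= leqn0 andbT; split=> [/eqP->|[/= x0 _]]; last exact/eqP.
  by split=> // -[|[|i]].
set s := rev (y :: l) in IHl *.
have sz : size s = (size l).+1 by rewrite /s size_rev.
have termE i : i <= size s -> 0 < i -> term (rcons s x) i = term s i.
  by move=> le_i i0; rewrite /term nth_rcons; case: ifP; lia.
have lastE : term (rcons s x) (size s).+1 = x.
  by rewrite /term nth_rcons ltnn eqxx.
have lev : level (y :: l) = (repetitions s).+1 by rewrite level_rev.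
rewrite rev_cons -/s /= -/(level (y :: l)) -/(rep_list (y :: l)) lev.
have upE i : i <= size s -> 1 < i ->
    repetitions_upto (rcons s x) (i - 2) = repetitions_upto s (i - 2).
  by move=> le_i gt_i; rewrite repetitions_upto_rcons; lia.
(* For the last letter, the cutoff [i - 2] is [size s - 1], so the bound counts every repetition of
   the prefix [s]. *)
have upL : repetitions_upto (rcons s x) ((size s).+1 - 2) = repetitions s.
  by rewrite /repetitions repetitions_upto_rcons ?sz //; lia.
rewrite termE ?sz //; split.
- case/andP=> le_x /IHl[s1 si]; split=> // i /andP[i2 le_i].
  have [lt_i|ge_i] := leqP i (size s).
    by rewrite termE ?upE //; [apply: si; rewrite i2 /= -sz|lia].
  have -> : i = (size s).+1 by lia.
  by rewrite lastE upL.
- case=> s1 si; apply/andP; split.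
    by have := si (size s).+1; rewrite lastE upL sz; apply; lia.
  apply/IHl; split=> // i /andP[i2 le_i].
  have := si i; rewrite termE ?upE ?sz //; last lia.
  by apply; rewrite i2 leqW.
Qed.

(** * Kernels as set partitions *)

Lemma size_undup_map (T : eqType) (rT1 rT2 : eqType) (f : T -> rT1)
    (g : T -> rT2) (s : seq T) :
  (forall i j, (f i == f j) = (g i == g j)) ->
  size (undup [seq f i | i <- s]) = size (undup [seq g i | i <- s]).
Proof.
move=> fg; elim: s => //= x s IHs.
have -> : (f x \in [seq f i | i <- s]) = (g x \in [seq g i | i <- s]).
  apply/mapP/mapP=> -[i si /eqP e]; exists i => //; apply/eqP.
    by rewrite -fg.
  by rewrite fg.
by case: ifP => //= _; rewrite IHs.
Qed.

Lemma pblock_preim_partition (T : finType) (rT : eqType) (f : T -> rT) i j :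
  (j \in finset.pblock (preim_partition f [set: T]) i) = (f i == f j).
Proof.
rewrite pblock_equivalence_partition ?inE //.
by split=> // /eqP->.
Qed.

Lemma eq_preim_partition (T : finType) (rT1 rT2 : eqType)
    (f : T -> rT1) (g : T -> rT2) :
  (preim_partition f [set: T] = preim_partition g [set: T]) <->
  (forall i j, (f i == f j) = (g i == g j)).
Proof.
split=> [fg i j|fg]; first by rewrite -!pblock_preim_partition fg.
rewrite /preim_partition /equivalence_partition.
apply: eq_imset => i; apply/finset.setP=> j.
by rewrite !inE fg.
Qed.

Lemma card_preim_partition (T : finType) (rT : eqType) (f : T -> rT) :
  #|preim_partition f [set: T]| = size (undup [seq f i | i <- enum T]).
Proof.
(* [h i] is the block of [i]; it has the same kernel as [f], and its distinct values are the
   blocks. *)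
pose h (i : T) := [set j : T | f i == f j]%SET.
rewrite (@size_undup_map _ _ _ f h) => [|i j]; last first.
  apply/eqP/eqP=> [fij|/finset.setP/(_ j)]; first by apply/finset.setP=> k; rewrite !inE fij.
  by rewrite !inE eqxx => /eqP.
rewrite -(card_uniqP (undup_uniq _)); apply: eq_card => B; rewrite mem_undup.
apply/imsetP/mapP=> -[i _ ->]; exists i; rewrite ?mem_enum ?inE //;
  by apply/finset.setP=> k; rewrite !inE.
Qed.

(* The word is not reversed back, so the element [i] of ['I_n] carries the
   letter of position [n - i]; a relabelling of the ground set is harmless. *)
Definition rep_partition (n : nat) (a : n.-tuple nat) : {set {set 'I_n}} :=
  preim_partition (fun i : 'I_n => nth 0 (rep_to_growth (rev a)) i) [set: 'I_n].

Lemma card_rep_partition n (a : n.-tuple nat) :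
  rep_list (rev a) -> #|rep_partition a| = level (rev a).
Proof.
move=> ra; have [_ <-] := rep_to_growthP ra.
rewrite card_preim_partition (map_comp (nth 0 _) val) val_enum_ord.
congr (size (undup _)); rewrite -[RHS](mkseq_nth 0) /mkseq.
by rewrite size_rep_to_growth size_rev size_tuple.
Qed.

Lemma repetition_sequencesP n (a : n.-tuple nat) :
  repetition_sequences n a <-> rep_list (rev a).
Proof. by rewrite rep_listP revK size_rev size_tuple. Qed.

Lemma rep_partition_bij n :
  set_bij (repetition_sequences n) [set P | P \in set_partitions n]
    (@rep_partition n).
Proof.
split=> [a _|a b|P].
- by rewrite /= inE; apply: preim_partitionP.
- rewrite !in_setE !repetition_sequencesP => ra rb /eq_preim_partition ker.
  apply: val_inj; apply: (can_inj revK); apply: rep_to_growth_inj => //.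
  apply: growth_list_kernel_inj; try by [apply: (rep_to_growthP _).1].
    by rewrite !size_rep_to_growth !size_rev !size_tuple.
  rewrite size_rep_to_growth size_rev size_tuple => i j lti ltj.
  exact: (ker (Ordinal lti) (Ordinal ltj)).
rewrite /= inE => partP.
(* Take the blocks themselves as letters: the kernel of this word is [P], and relabelling then
   decoding it gives the preimage. *)
set s := [seq finset.pblock P i | i <- enum 'I_n].
have szs : size s = n by rewrite size_map size_enum_ord.
have [v [gv sv ker]] := growth_list_kernel_surj finset.set0 s.
have [l rl lv] := rep_to_growth_surj gv.
have sz : size (rev l) == n by rewrite size_rev -(size_rep_to_growth l) lv sv szs.
exists (Tuple sz); first by apply/repetition_sequencesP; rewrite revK.
rewrite -[RHS](preim_partition_pblock partP) /rep_partition /= revK lv.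
have nths (k : 'I_n) : nth finset.set0 s k = finset.pblock P k.
  by rewrite /s (nth_map k) ?nth_ord_enum // size_enum_ord.
by apply/eq_preim_partition => i j; rewrite ker ?szs ?nths.
Qed.

Unset Implicit Arguments.

Theorem mainTheorem1 (n : nat) (hn : 1 <= n) :
  (exists f : n.-tuple nat -> {set {set 'I_n}},
      set_bij (repetition_sequences n) [set P | P \in set_partitions n] f /\
      (forall a : n.-tuple nat, repetition_sequences n a ->
         repetitions a = #|f a| - 1)) /\
  repetition_sequences n #= `I_(bell n).
Proof.
have bij := rep_partition_bij n.
split.
  exists (@rep_partition n); split=> // a /repetition_sequencesP ra.
  rewrite card_rep_partition // level_rev ?revK ?subn1 //.
  (* [level] exceeds the number of repetitions by one only on nonempty words; here [1 <= n]
     enters. *)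
  by rewrite -size_eq0 size_rev size_tuple -lt0n.
have [fR injR surjR] := bij.
(* The sequences are equipotent to their image, which is the whole set of partitions; that set is
   then counted as a finite set. *)
apply: card_eq_trans (card_esym (inj_card_eq injR)) _.
rewrite (surj_image_eq _ surjR); last by move=> _ [a Ra <-]; apply: fR.
have -> : [set P | P \in set_partitions n] =
    [set` seq_fset tt (enum (set_partitions n))].
  by apply/eq_set => P; rewrite seq_fsetE mem_enum.
by apply/card_eq_fsetP; rewrite size_seq_fset undup_id ?enum_uniq // -cardE.
Qed.
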